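(* For long virtual knots $K_1,K_2$ (framed or unframed), the polynomial invariant $p_t$ is additive under connected sum, $p_t(K_1\# K_2)=p_t(K_1)+p_t(K_2)$, and it is independent of the order of the sum, $p_t(K_1\#K_2)=p_t(K_2\#K_1)$.
   Context: A long virtual knot diagram is an immersion $\mathbb{R}\to\mathbb{R}^2$ which coincides with the $x$-axis outside some closed ball centered at the origin and whose double points are decorated either as classical crossings (with over/under information, hence a sign $\mathrm{sgn}=\pm1$) or as virtual crossings. Long virtual knots (unframed) are diagrams modulo the classical Reidemeister moves 1, 2, 3, the purely virtual Reidemeister moves 1, 2, 3, and the mixed move (sliding an arc carrying only virtual crossings past a classical crossing). Framed long virtual knots are defined in the same way, except that classical Reidemeister move 1 is replaced by the framed Reidemeister move 1, which inserts or removes on an arc two consecutive kinks whose classical crossings have opposite signs. The connected sum $K_1\#K_2$ is the long knot obtained by concatenation, glueing the end of $K_1$ to the beginning of $K_2$. For a classical crossing $d$ of $K$, smooth $d$ according to orientation to obtain a two-component virtual tangle (one long component and one closed component), and forget the over/under information. Choose an ordering $\{1,2\}$ of the two components. For a classical crossing $x$ between the two components ($x\in1\cap2$) let $\mathrm{sgn}(x)=+1$ if the tangent vectors at $x$ (of component 1, of component 2), in this order, form a positively oriented basis of the plane, and $-1$ otherwise. The intersection index is $i(d)=\sum_{x\in1\cap2}\mathrm{sgn}(x)$; its absolute value does not depend on the ordering. The polynomial invariant, summing over all classical crossings, is $$p_t(K)=\sum_d \mathrm{sgn}(d)(t^{|i(d)|}-1)\ \text{(unframed case)},\qquad p_t(K)=\sum_d\mathrm{sgn}(d)\,t^{|i(d)|}\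 \text{(framed case)}.$$ *)

(* Defs.v *)
From mathcomp Require Import all_boot all_order all_algebra.
From mathcomp Require Import all_classical all_reals all_analysis.
From mathcomp Require Import lra ring.
From Stdlib Require Import Relation_Operators.

Set Implicit Arguments.
Unset Strict Implicit.
Unset Printing Implicit Defensive.

Import Order.TTheory GRing.Theory Num.Theory numFieldNormedType.Exports.

Local Open Scope classical_set_scope.
Local Open Scope ring_scope.

(* [Ck k f]: all iterated directional derivatives of order less than [k] exist
   and are differentiable, and those of order [k] are continuous. *)
Fixpoint Ck {R : realType} {V W : normedModType R} (k : nat) (f : V -> W) : Prop :=
  match k with
  | 0 => continuous f
  | k'.+1 => (forall x, differentiable f x) /\
             (forall v, Ck k' (fun x => 'D_v f x))
  end.

Definition smooth {R : realType} {V W : normedModType R} (f : V -> W) : Prop :=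
  forall k, Ck k f.

Definition det2 {R : realType} (u v : R * R) : R := u.1 * v.2 - u.2 * v.1.

(* The inverse of such a map is smooth by the inverse function theorem. *)
Definition plane_diffeo {R : realType} (F : R * R -> R * R) : Prop :=
  [/\ smooth F, bijective F &
      forall p, 0 < det2 ('D_((1, 0) : R * R) F p) ('D_((0, 1) : R * R) F p)].

Definition reparametrization {R : realType} (h : R -> R) : Prop :=
  [/\ smooth h, bijective h & forall t, 0 < derive1 h t].

Definition disc {R : realType} (r : R) : set (R * R) :=
  [set p | p.1 ^+ 2 + p.2 ^+ 2 <= r ^+ 2].

Definition smooth_disc {R : realType} (U : set (R * R)) : Prop :=
  exists2 F, plane_diffeo F & U = F @` disc 1.

(* Outside [disc r], [f] is the x-axis with its standard parametrization. *)
Definition axis_outside {R : realType} (r : R) (f : R -> R * R) : Prop :=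
  (forall t, r < `|t| -> f t = (t, 0)) /\ (forall t, `|t| <= r -> disc r (f t)).

Definition double_points {R : realType} (f : R -> R * R) : set (R * R) :=
  [set d | d.1 < d.2 /\ f d.1 = f d.2].

Inductive strand_info := Over | Under | Virtual.

Definition opposite (o : strand_info) : strand_info :=
  match o with Over => Under | Under => Over | Virtual => Virtual end.

(* [info s t] describes the double point [curve s = curve t] (with [s <> t]) as
   seen from the strand through parameter [s]; it is irrelevant for other pairs
   of parameters. *)
Record diagram (R : realType) := Diagram {
  curve : R -> R * R;
  info : R -> R -> strand_info;
  curve_smooth : smooth curve;
  curve_immersion : forall t, derive1 curve t != 0;
  curve_long : exists2 r : R, 0 < r & axis_outside r curve;
  curve_finite : finite_set (double_points curve);
  curve_no_triple : forall s t u, s < t -> t < u ->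
    ~ (curve s = curve t /\ curve t = curve u);
  curve_transverse : forall s t, s < t -> curve s = curve t ->
    det2 (derive1 curve s) (derive1 curve t) != 0;
  info_sym : forall s t, s <> t -> curve s = curve t ->
    info t s = opposite (info s t)
}.

Section Diagrams.
Context {R : realType}.
Implicit Types (D : diagram R) (s t : R) (d x : R * R).

Definition velocity D : R -> R * R := derive1 (curve D).

(* The sign of the basis (tangent at s, tangent at t), as an integer. *)
Definition tangent_sign D s t : int := sgz (det2 (velocity D s) (velocity D t)).

(* Positive iff (tangent of the over strand, tangent of the under strand) is a
   positively oriented basis. *)
Definition crossing_sign D s t : int :=
  match info D s t with
  | Over => tangent_sign D s t
  | Under => tangent_sign D t s
  | Virtual => 0
  end.

(* Each classical crossing is recorded once, by its two parameters in increasing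
   order. *)
Definition classical_crossings D : set (R * R) :=
  [set d | double_points (curve D) d /\ info D d.1 d.2 <> Virtual].

(* The oriented smoothing at [d] separates the parameter line (minus the two
   parameters of [d]) into a closed and a long component. *)
Definition closed_component d : set R := [set u | d.1 < u < d.2].
Definition long_component d : set R := [set u | u < d.1 \/ d.2 < u].

(* A crossing between the components is recorded by the pair (its parameter on
   the closed component, its parameter on the long component). *)
Definition component_crossings D d : set (R * R) :=
  [set x | [/\ closed_component d x.1, long_component d x.2,
               curve D x.1 = curve D x.2 & info D x.1 x.2 <> Virtual]].

(* The closed component is ordered first; the other ordering changes the sign. *)
Definition intersection_index D d : int :=
  \sum_(x \in component_crossings D d) tangent_sign D x.1 x.2.

End Diagrams.

Inductive framing := Unframed | Framed.

Definition crossing_weight (fr : framing) (i : int) : {poly int} :=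
  match fr with
  | Unframed => 'X^(absz i) - 1
  | Framed => 'X^(absz i)
  end.

Definition diagram_polynomial {R : realType} (fr : framing) (D : diagram R) :
    {poly int} :=
  \sum_(d \in classical_crossings D)
    crossing_sign D d.1 d.2 *: crossing_weight fr (intersection_index D d).

Section Moves.
Context {R : realType}.
Implicit Types (D : diagram R) (A : set R).

Definition planar_isotopy D D' : Prop :=
  exists (F : R * R -> R * R) (h : R -> R), [/\ plane_diffeo F, reparametrization h,
    forall t, curve D' t = F (curve D (h t)) &
    forall s t, s <> t -> curve D' s = curve D' t ->
      info D' s t = info D (h s) (h t)].

(* [D] and [D'] differ only inside the disc [U], whose preimage under both
   curves is [A]. *)
Definition local_change (U : set (R * R)) A D D' : Prop :=
  [/\ smooth_disc U,
      forall t, A t -> U (curve D t) /\ U (curve D' t),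
      forall t, ~ A t -> ~ U (curve D t) /\ curve D' t = curve D t &
      forall s t, ~ A s -> ~ A t -> s <> t -> curve D s = curve D t ->
        info D' s t = info D s t].

Definition double_points_on A D : set (R * R) :=
  [set d | [/\ double_points (curve D) d, A d.1 & A d.2]].

(* In a disc met in a single arc: a simple arc is replaced by a kink, i.e. an
   arc with one double point. *)
Definition kink_move (is_allowed : strand_info -> Prop) D D' : Prop :=
  exists (U : set (R * R)) (a b s t : R),
  [/\ local_change U `[a, b] D D',
      double_points_on `[a, b] D = set0,
      double_points_on `[a, b] D' = [set (s, t)],
      a < s /\ t < b &
      is_allowed (info D' s t)].

(* In a disc met in a single arc: a simple arc is replaced by an arc with two
   consecutive kinks of opposite signs. *)
Definition double_kink_move D D' : Prop :=
  exists (U : set (R * R)) (a b s1 t1 s2 t2 : R),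
  [/\ local_change U `[a, b] D D',
      double_points_on `[a, b] D = set0,
      double_points_on `[a, b] D' = [set (s1, t1); (s2, t2)],
      [/\ a < s1, t1 < s2 & t2 < b] &
      [/\ info D' s1 t1 <> Virtual, info D' s2 t2 <> Virtual &
          crossing_sign D' s1 t1 = - crossing_sign D' s2 t2]].

(* In a disc met in two arcs: two disjoint simple arcs are replaced by two simple
   arcs meeting twice. The condition on signs is automatic in a disc. *)
Definition bigon_move (is_allowed : strand_info -> Prop) D D' : Prop :=
  exists (U : set (R * R)) (a1 b1 a2 b2 s1 s2 t1 t2 : R),
  [/\ b1 < a2 /\ local_change U (`[a1, b1] `|` `[a2, b2]) D D',
      double_points_on (`[a1, b1] `|` `[a2, b2]) D = set0,
      double_points_on (`[a1, b1] `|` `[a2, b2]) D' = [set (s1, t1); (s2, t2)],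
      [/\ a1 < s1, s1 < s2, s2 < b1 & (a2 < t1 < b2 /\ a2 < t2 < b2)] &
      [/\ info D' s1 t1 = info D' s2 t2, is_allowed (info D' s1 t1) &
          crossing_sign D' s1 t1 = - crossing_sign D' s2 t2]].

(* In the chart [F], the disc [F @` disc 1] is met in three straight oriented
   chords, parametrized on [a i, b i], any two of which cross; [c i j] is the
   parameter on chord [i] of its crossing with chord [j]. *)
Definition straight_triangle (F : R * R -> R * R) (a b : 'I_3 -> R)
    (c : 'I_3 -> 'I_3 -> R) D : Prop :=
  [/\ plane_diffeo F,
      exists (p v : 'I_3 -> R * R) (h : 'I_3 -> R -> R), forall i,
        smooth (h i) /\
        (forall t, t \in `[a i, b i] ->
           0 < derive1 (h i) t /\ curve D t = F (p i + h i t *: v i)) &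
      forall i j, i != j ->
        a i < c i j < b i /\ curve D (c i j) = curve D (c j i)].

(* The move across a triangle: the order of the two crossings is reversed along
   each of the three strands, while each crossing keeps its over/under/virtual
   decoration and its sign (the latter is automatic, the ends of the strands
   being fixed). *)
Definition triangle_move (is_allowed : ('I_3 -> 'I_3 -> strand_info) -> Prop)
    D D' : Prop :=
  exists (F F' : R * R -> R * R) (a b : 'I_3 -> R) (c c' : 'I_3 -> 'I_3 -> R),
  let A := [set t | exists i, t \in `[a i, b i]] in
  [/\ forall i j, i != j -> b i < a j \/ b j < a i,
      F @` disc 1 = F' @` disc 1 /\ local_change (F @` disc 1) A D D',
      straight_triangle F a b c D /\ straight_triangle F' a b c' D',
      forall i j k, i != j -> j != k -> i != k ->
        (c i j < c i k) = (c' i k < c' i j) &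
      [/\ forall i j, i != j ->
            info D (c i j) (c j i) = info D' (c' i j) (c' j i),
          forall i j, i != j ->
            tangent_sign D (c i j) (c j i) = tangent_sign D' (c' i j) (c' j i) &
          is_allowed (fun i j => info D (c i j) (c j i))]].

Definition is_classical (o : strand_info) : Prop := o <> Virtual.
Definition is_virtual (o : strand_info) : Prop := o = Virtual.

Definition layered (o : 'I_3 -> 'I_3 -> strand_info) : Prop :=
  exists height : 'I_3 -> nat, forall i j, i != j ->
    o i j = if (height j < height i)%N then Over else Under.

Definition all_virtual (o : 'I_3 -> 'I_3 -> strand_info) : Prop :=
  forall i j, i != j -> o i j = Virtual.

(* Strand [i] carries only virtual crossings, the other two cross classically. *)
Definition mixed (o : 'I_3 -> 'I_3 -> strand_info) : Prop :=
  exists i, (forall j, i != j -> o i j = Virtual) /\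
            (forall j k, i != j -> i != k -> j != k -> o j k <> Virtual).

Inductive move : framing -> diagram R -> diagram R -> Prop :=
| Isotopy fr D D' : planar_isotopy D D' -> move fr D D'
| Reidemeister1 D D' : kink_move is_classical D D' -> move Unframed D D'
| FramedReidemeister1 D D' : double_kink_move D D' -> move Framed D D'
| Reidemeister2 fr D D' : bigon_move is_classical D D' -> move fr D D'
| Reidemeister3 fr D D' : triangle_move layered D D' -> move fr D D'
| VirtualReidemeister1 fr D D' : kink_move is_virtual D D' -> move fr D D'
| VirtualReidemeister2 fr D D' : bigon_move is_virtual D D' -> move fr D D'
| VirtualReidemeister3 fr D D' : triangle_move all_virtual D D' -> move fr D D'
| MixedMove fr D D' : triangle_move mixed D D' -> move fr D D'.

Definition equivalent (fr : framing) : diagram R -> diagram R -> Prop :=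
  clos_refl_sym_trans _ (move fr).

(* [D] runs through a copy of [D1] translated to the left by [a], then through a
   copy of [D2] translated to the right by [b], with the long straight ends of
   the two copies glued at the origin. *)
Definition concatenation D1 D2 D : Prop :=
  exists r1 r2 a b : R,
  [/\ (0 < r1 < a /\ axis_outside r1 (curve D1)) /\
      (0 < r2 < b /\ axis_outside r2 (curve D2)),
      forall t : R, t <= 0 -> curve D t = curve D1 (t + a) - (a, 0),
      forall t : R, 0 <= t -> curve D t = curve D2 (t - b) + (b, 0),
      forall s t : R, s <= 0 -> t <= 0 -> s <> t -> curve D s = curve D t ->
        info D s t = info D1 (s + a) (t + a) &
      forall s t : R, 0 <= s -> 0 <= t -> s <> t -> curve D s = curve D t ->
        info D s t = info D2 (s - b) (t - b)].

End Moves.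

(* Any two diagrams can be concatenated. *)
Section Existence.
Context {R : realType}.

Lemma derive_translate (W : normedModType R) (g : R -> W) (a : R) (c : W) v x :
  'D_v (fun t => g (t + a) + c) x = 'D_v g (x + a).
Proof.
rewrite /derive.
rewrite (_ : (fun h => h^-1 *: ((_ \o shift x) (h *: v) - _)) =
  (fun h => h^-1 *: ((g \o shift (x + a)) (h *: v) - g (x + a)))) //.
apply/funext => h /=; congr (_ *: _).
by rewrite addrA opprD addrACA subrr addr0.
Qed.

Lemma differentiable_translate (W : normedModType R) (g : R -> W) (a : R) (c : W) x :
  differentiable g (x + a) -> differentiable (fun t => g (t + a) + c) x.
Proof.
move=> /derivable1_diffP H; apply/derivable1_diffP; move: H.
rewrite /derivable => H.
rewrite (_ : (fun h => _) = (fun h => h^-1 *: ((g \o shift (x + a)) (h *: 1) - g (x + a)))) //.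
apply/funext => h /=; congr (_ *: _).
by rewrite addrA opprD addrACA subrr addr0.
Qed.

Lemma Ck_translate (W : normedModType R) k (g : R -> W) (a : R) (c : W) :
  Ck k g -> Ck k (fun t => g (t + a) + c).
Proof.
elim: k g c => [|k IH] g c /=.
  move=> cg x.
  have H : (fun t => g (t + a)) @ x --> g (x + a).
    have sh : (fun t : R => t + a) @ x --> x + a.
      by apply: (@continuousD _ R R (fun t => t) (fun=> a)); [exact: cvg_id | exact: cvg_cst].
    exact: (cvg_comp _ _ sh (cg (x + a))).
  by apply: (@continuousD _ W R (fun t => g (t + a)) (fun=> c)); [exact: H | exact: cvg_cst].
move=> [dg Dg]; split=> [x|v]; first exact: differentiable_translate.
have -> : (fun x => 'D_v (fun t => g (t + a) + c) x) = (fun t => 'D_v g (t + a) + 0).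
  by apply/funext => x; rewrite derive_translate addr0.
exact: (IH (fun x => 'D_v g x) 0 (Dg v)).
Qed.

Lemma Ck_local (W : normedModType R) k (f : R -> W) :
  (forall x : R, exists2 g : R -> W, Ck k g & {near x, g =1 f}) -> Ck k f.
Proof.
elim: k f => [|k IH] f /= H.
  move=> x; have [g cg fg] := H x.
  rewrite /continuous_at -(nbhs_singleton fg).
  apply: cvg_trans (cg x); exact: near_eq_cvg fg.
split=> [x|v].
  have [g [dg _] fg] := H x.
  apply/derivable1_diffP; apply: near_eq_derivable fg _.
  exact/derivable1_diffP.
apply: IH => x; have [g [_ Dg] fg] := H x.
exists (fun x => 'D_v g x); first exact: Dg.
move/near_join: fg; apply: filterS => y fy; exact: near_eq_derive. Qed.

Lemma sqle (x r : R) : 0 <= r -> (x ^+ 2 <= r ^+ 2) = (`|x| <= r).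
Proof. by move=> r0; rewrite -[x ^+ 2]real_normK ?num_real // ler_pXn2r // ?nnegrE. Qed.

Lemma axis_bound (r : R) f t : 0 < r -> axis_outside r f ->
  (t <= r -> (f t).1 <= r) * (- r <= t -> - r <= (f t).1).
Proof.
move=> r0 [H1 H2]; case: (ltP r `|t|) => ht.
  by rewrite H1 //=.
have := H2 _ ht; rewrite /disc /= => h.
have: (f t).1 ^+ 2 <= r ^+ 2 by apply: le_trans h; rewrite lerDl sqr_ge0.
rewrite sqle; last exact: ltW.
by rewrite ler_norml => /andP[? ?]; split.
Qed.

Lemma concatenation_exists (D1 D2 : diagram R) : exists D, concatenation D1 D2 D.
Proof.
have [r1 r10 ax1] : exists2 r : R, 0 < r & axis_outside r (curve D1) := curve_long D1.
have [r2 r20 ax2] : exists2 r : R, 0 < r & axis_outside r (curve D2) := curve_long D2.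
pose a : R := r1 + 1; pose b : R := r2 + 1.
pose g1 (t : R) : R * R := curve D1 (t + a) - (a, 0).
pose g2 (t : R) : R * R := curve D2 (t - b) + (b, 0).
pose f (t : R) : R * R := if t <= 0 then g1 t else g2 t.
have mid1 (t : R) : -1 < t -> g1 t = (t, 0).
  move=> ht; rewrite /g1 ax1.1; first by congr pair => /=; rewrite ?subr0 //; lra.
  rewrite ger0_norm /a; lra.
have mid2 (t : R) : t < 1 -> g2 t = (t, 0).
  move=> ht; rewrite /g2 ax2.1; first by congr pair => /=; rewrite ?addr0 //; lra.
  rewrite ler0_norm /b; lra.
have f1 (t : R) : t < 1 -> f t = g1 t.
  by rewrite /f; case: ifP => // /negbT; rewrite -ltNge => h1 h2; rewrite mid2 // mid1 //; lra.
have f2 (t : R) : -1 < t -> f t = g2 t.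
  by rewrite /f; case: ifP => // h1 h2; rewrite mid2 ?mid1 //; lra.
have near1 (t : R) : t < 1 -> {near t, g1 =1 f}.
  move=> ht; near=> y; rewrite f1 //; near: y; exact: lt_nbhsl.
have near2 (t : R) : -1 < t -> {near t, g2 =1 f}.
  move=> ht; near=> y; rewrite f2 //; near: y; exact: lt_nbhsr.
have cases (t : R) : t < 1 \/ -1 < t by case: (ltP t 1) => h; [left|right] => //; lra.
have d1 (t : R) : t < 1 -> derive1 f t = derive1 (curve D1) (t + a).
  move=> ht; rewrite !derive1E -(@near_eq_derive R R _ g1 f t 1 (near1 _ ht)).
  exact: derive_translate.
have d2 (t : R) : -1 < t -> derive1 f t = derive1 (curve D2) (t - b).
  move=> ht; rewrite !derive1E -(@near_eq_derive R R _ g2 f t 1 (near2 _ ht)).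
  exact: derive_translate.
have x1 (t : R) : t <= -1 -> (f t).1 <= -1.
  move=> ht; rewrite f1; last by lra.
  rewrite /g1 /=; have := (@axis_bound r1 _ (t+a) r10 ax1).1; rewrite /a; move=> h.
  have {}h := h ltac:(lra). rewrite /a in h *; lra.
have x2 (t : R) : 1 <= t -> 1 <= (f t).1.
  move=> ht; rewrite f2; last by lra.
  rewrite /g2 /=; have := (@axis_bound r2 _ (t-b) r20 ax2).2; rewrite /b; move=> h.
  have {}h := h ltac:(lra). rewrite /b in h *; lra.
have xm (t : R) : -1 < t -> t < 1 -> f t = (t, 0) by move=> h1 h2; rewrite f1 // mid1.
have sep (s t : R) : s < t -> f s = f t -> t <= -1 \/ 1 <= s.
  move=> st e.
  case: (leP t (-1)) => ht; first by left.
  case: (leP 1 s) => hs; first by right.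
  exfalso; have e1 : (f s).1 = (f t).1 by rewrite e.
  case: (leP s (-1)) => hs'.
    have := x1 _ hs'.
    case: (leP 1 t) => ht'; first by have := x2 _ ht'; lra.
    by rewrite e1 xm //=; lra.
  rewrite xm // in e1.
  case: (leP 1 t) => ht'; first by have := x2 _ ht'; move: e1 => /=; lra.
  by move: e1; rewrite xm //=; lra.
have g1E (s t : R) : g1 s = g1 t -> curve D1 (s + a) = curve D1 (t + a) by move=> /addIr.
have g2E (s t : R) : g2 s = g2 t -> curve D2 (s - b) = curve D2 (t - b) by move=> /addIr.
pose o (s t : R) := if s <= 0 then info D1 (s + a) (t + a) else info D2 (s - b) (t - b).
have sm : smooth f.
  move=> k; apply: Ck_local => x; case: (cases x) => hx.
    by exists g1; [exact: Ck_translate (curve_smooth D1 k) | exact: near1].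
  by exists g2; [exact: Ck_translate (curve_smooth D2 k) | exact: near2].
have imm (t : R) : derive1 f t != 0.
  by case: (cases t) => h; [rewrite d1 //|rewrite d2 //]; exact: curve_immersion.
have tri (s t u : R) : s < t -> t < u -> ~ (f s = f t /\ f t = f u).
  move=> st tu [e1 e2]; case: (sep _ _ tu e2) => h.
    rewrite !f1 in e1 e2; try lra.
    apply: (@curve_no_triple _ D1 (s + a) (t + a) (u + a)); rewrite ?ltrD2r //.
    by split; apply: g1E.
  case: (sep _ _ st e1) => h'; first lra.
  rewrite !f2 in e1 e2; try lra.
  apply: (@curve_no_triple _ D2 (s - b) (t - b) (u - b)); rewrite ?ltrD2r //.
  by split; apply: g2E.
have tra (s t : R) : s < t -> f s = f t -> det2 (derive1 f s) (derive1 f t) != 0.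
  move=> st e; case: (sep _ _ st e) => h.
    rewrite !d1; try lra.
    by apply: curve_transverse; rewrite ?ltrD2r //; apply: g1E; rewrite -!f1 //; lra.
  rewrite !d2; try lra.
  by apply: curve_transverse; rewrite ?ltrD2r //; apply: g2E; rewrite -!f2 //; lra.
have isym (s t : R) : s <> t -> f s = f t -> o t s = opposite (o s t).
  move=> st e.
  have : (s <= -1 /\ t <= -1) \/ (1 <= s /\ 1 <= t).
    move/eqP: st; rewrite neq_lt => /orP[] h; [case: (sep _ _ h e)|case: (sep _ _ h (esym e))]; lra.
  rewrite /o => -[[hs ht]|[hs ht]].
    have -> : s <= 0 by lra.
    have -> : t <= 0 by lra.
    apply: info_sym; first by move/addIr.
    by apply: g1E; rewrite -!f1 //; lra.
  have -> : (s <= 0) = false by apply/negbTE; rewrite -ltNge; lra.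
  have -> : (t <= 0) = false by apply/negbTE; rewrite -ltNge; lra.
  apply: info_sym; first by move/addIr.
  by apply: g2E; rewrite -!f2 //; lra.
have fin : finite_set (double_points f).
  pose h1 (d : R * R) := (d.1 - a, d.2 - a).
  pose h2 (d : R * R) := (d.1 + b, d.2 + b).
  apply: (@sub_finite_set _ _ ((h1 @` double_points (curve D1)) `|` (h2 @` double_points (curve D2)))).
    move=> [s t] [/= st e]; case: (sep _ _ st e) => h.
      left; exists (s + a, t + a); last by rewrite /h1 /= !addrK.
      by split; rewrite /= ?ltrD2r //; apply: g1E; rewrite -!f1 //; lra.
    right; exists (s - b, t - b); last by rewrite /h2 /= !subrK.
    by split; rewrite /= ?ltrD2r //; apply: g2E; rewrite -!f2 //; lra.
  by rewrite finite_setU; split; apply: finite_image; exact: curve_finite.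
have lng : exists2 r : R, 0 < r & axis_outside r f.
  pose r : R := r1 + a + r2 + b.
  have a0 : 0 < a by rewrite /a; lra.
  have b0 : 0 < b by rewrite /b; lra.
  exists r; first by rewrite /r; lra.
  split=> t ht.
    rewrite /f; case: ifP => [h|/negbT]; last rewrite -ltNge => h.
      rewrite ler0_norm // /r in ht.
      rewrite /g1 ax1.1; first by congr pair => /=; rewrite ?subr0 //; lra.
      rewrite ler0_norm; lra.
    rewrite gtr0_norm // /r in ht.
    rewrite /g2 ax2.1; first by congr pair => /=; rewrite ?addr0 //; lra.
    rewrite ger0_norm; lra.
  have trans (r0 c : R) (p : R * R) : 0 < r0 -> r0 + `|c| <= r -> disc r0 p -> disc r (p + (c, 0)).
    rewrite /disc /= addr0 => r00 hc hp.
    have h : p.1 ^+ 2 <= r0 ^+ 2 by apply: le_trans hp; rewrite lerDl sqr_ge0.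
    rewrite sqle in h; last exact: ltW.
    have hh : p.1 * c <= r0 * `|c|.
      apply: le_trans (ler_norm _) _; rewrite normrM ler_wpM2r //.
    have : (r0 + `|c|) ^+ 2 <= r ^+ 2.
      rewrite sqle; last by have := normr_ge0 c; lra.
      rewrite ger0_norm //; have := normr_ge0 c; lra.
    have : `|c| ^+ 2 = c ^+ 2 by rewrite real_normK ?num_real.
    have -> : (p.1 + c) ^+ 2 = p.1 ^+ 2 + 2 * (p.1 * c) + c ^+ 2 by ring.
    have -> : (r0 + `|c|) ^+ 2 = r0 ^+ 2 + 2 * (r0 * `|c|) + `|c| ^+ 2 by ring.
    move: hp hh; clear.
    move: (p.1 ^+ 2) (p.1 * c) (c ^+ 2) (r0 ^+ 2) (r0 * `|c|) (`|c| ^+ 2) (p.2 ^+ 2) (r ^+ 2).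
    move=> A B C E F G H I; lra.
  have axd : disc r (t, 0).
    rewrite /disc /= expr0n addr0 sqle // /r; lra.
  rewrite /f; case: ifP => [h|/negbT]; last rewrite -ltNge => h.
    case: (lerP `|t + a| r1) => h'.
      rewrite /g1 (_ : - (a, 0) = (- a, 0)); last by congr pair; rewrite ?oppr0.
      by apply: (trans r1); rewrite ?normrN ?gtr0_norm // /r; [lra|apply: ax1.2].
    rewrite /g1 ax1.1 // (_ : _ - _ = (t, 0)) //.
    by congr pair => /=; rewrite ?subr0 //; lra.
  case: (lerP `|t - b| r2) => h'.
    by apply: (trans r2); rewrite ?gtr0_norm // /r; [lra|apply: ax2.2].
  rewrite /g2 ax2.1 // (_ : _ + _ = (t, 0)) //.
  by congr pair => /=; rewrite ?addr0 //; lra.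
exists (Diagram sm imm lng fin tri tra isym).
exists r1, r2, a, b; split=> //=.
- by rewrite /a /b; do 2!split => //; rewrite ?r10 ?r20 /=; lra.
- by move=> t t0; rewrite f1 //; lra.
- by move=> t t0; rewrite f2 //; lra.
- by move=> s t s0 t0 _ _; rewrite /o s0.
- move=> s t s0 t0 st e; rewrite /o.
  have -> // : (s <= 0) = false.
  apply/negbTE; rewrite -ltNge.
  move/eqP: st; rewrite neq_lt => /orP[] h; [case: (sep _ _ h e)|case: (sep _ _ h (esym e))]; lra.
Unshelve. all: by end_near. Qed.

End Existence.

Record long_virtual_knot (R : realType) (fr : framing) := LongVirtualKnot {
  diagrams_of : set (diagram R);
  knot_class : exists D, diagrams_of = [set D' | equivalent fr D D']
}.

Section Knots.
Context {R : realType} {fr : framing}.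
Implicit Types K : long_virtual_knot R fr.

Definition knot_of (D : diagram R) : long_virtual_knot R fr :=
  LongVirtualKnot (ex_intro _ D erefl).

Definition representative K : diagram R := projT1 (cid (knot_class K)).

(* Independent of the representative, as moves preserve [diagram_polynomial]. *)
Definition p_t K : {poly int} := diagram_polynomial fr (representative K).

(* [K] is the knot of a concatenation of some diagrams of [K1] and [K2]. *)
Definition connected_sum K1 K2 K : Prop :=
  exists D1 D2 D, [/\ diagrams_of K1 D1, diagrams_of K2 D2, diagrams_of K D &
                      concatenation D1 D2 D].

Lemma connected_sum_exists K1 K2 : exists K, connected_sum K1 K2 K.
Proof.
have rep K : diagrams_of K (representative K).
  rewrite /representative; case: cid => D e /=; rewrite e.
  exact: rst_refl.
have [D hD] := concatenation_exists (representative K1) (representative K2).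
exists (knot_of D), (representative K1), (representative K2), D.
by split; [exact: rep | exact: rep | exact: rst_refl | exact: hD].
Qed.

End Knots.

(* Main.v *)
(* Encode every double point as a chord of the parameter line. The intersection
   index of a chord [d] is then the sum, over all chords, of the tangent sign
   times the difference of the indicators of the open interval spanned by [d] at
   the two ends, so the polynomial is a function of the signed chord diagram.
   A Reidemeister move changes the chords inside a disc only. The arcs crossing
   the disc are intervals of parameters, on each of which the indicator of an
   outer chord is constant; hence outer indices change by a sum over the inner
   chords, which vanishes for kinks, cancels in pairs for a bigon and is the same
   on both sides of a triangle move. The only geometry is in the triangle move:
   the index of one of its crossings depends on where the other two lie along the
   strands, and the linear relation between the sides of a triangle shows that
   the two contributions exchanged by the move agree. In a concatenation no chord
   joins the two halves, so the chord sums, and the polynomials, add up. *)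
Require Import Defs.
From mathcomp Require Import all_boot all_order all_algebra.
From mathcomp Require Import all_classical all_reals all_analysis.
From mathcomp Require Import lra ring.

Set Implicit Arguments.
Unset Strict Implicit.
Unset Printing Implicit Defensive.

Import Order.TTheory GRing.Theory Num.Theory numFieldNormedType.Exports.

Local Open Scope classical_set_scope.
Local Open Scope ring_scope.

(** * Intersection indices and the polynomial as sums over chords *)

Section ChordIndex.
Context {R : realType}.
Implicit Types (D : diagram R) (s t u : R) (d x : R * R).

Lemma det2C (u v : R * R) : det2 v u = - det2 u v.
Proof. by rewrite /det2 opprB mulrC [X in _ - X]mulrC. Qed.

Lemma tangent_signC D s t : tangent_sign D t s = - tangent_sign D s t.
Proof. by rewrite /tangent_sign -sgzN -det2C. Qed.

(** Unlike [crossing_sign] it forgets over/under and is antisymmetric at double points. Its product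
    with a difference of indicators therefore does not depend on the order of the two ends. *)
Definition chord_sign D s t : int :=
  if info D s t is Virtual then 0 else tangent_sign D s t.

Lemma chord_sign_classical D s t : info D s t <> Virtual ->
  chord_sign D s t = tangent_sign D s t.
Proof. by rewrite /chord_sign; case: (info D s t). Qed.

Lemma chord_sign_virtual D s t : info D s t = Virtual -> chord_sign D s t = 0.
Proof. by rewrite /chord_sign => ->. Qed.

Lemma chord_signC D s t : s <> t -> curve D s = curve D t ->
  chord_sign D t s = - chord_sign D s t.
Proof.
move=> st e; rewrite /chord_sign (info_sym st e).
by case: (info D s t) => /=; rewrite ?oppr0 // tangent_signC.
Qed.

Definition between d u : int := (d.1 < u < d.2)%R%:R.

(** The set [P] is kept variable in order to restrict the sum to the chords of a disc or of one half
    of a concatenation. *)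
Definition chord_sum (P : set (R * R)) D d : int :=
  \sum_(x \in P) chord_sign D x.1 x.2 * (between d x.1 - between d x.2).

(* The two components of the smoothing at [d] meet exactly in the chords having
   one end in the open interval between the ends of [d]. *)
Lemma intersection_indexE D d : double_points (curve D) d ->
  intersection_index D d = chord_sum (double_points (curve D)) D d.
Proof.
move=> [d12 ed].
pose inside (u : R) := d.1 < u < d.2.
(* The parameter [t] is not an end of [d], since [s] would then make that double point a triple
   point. *)
have insideP s t : s <> t -> curve D s = curve D t -> inside s -> ~~ inside t ->
    t < d.1 \/ d.2 < t.
  move=> st e /andP[h1 h2]; rewrite /inside negb_and -!leNgt => /orP[].
    rewrite le_eqVlt => /orP[/eqP td|]; last by left.
    by case: (@curve_no_triple _ D d.1 s d.2) => //; rewrite -ed -td e.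
  rewrite le_eqVlt => /orP[/eqP td|]; last by right.
  by case: (@curve_no_triple _ D d.1 s d.2) => //; rewrite ed td e.
pose S := [set x | [/\ double_points (curve D) x, info D x.1 x.2 <> Virtual &
   inside x.1 != inside x.2]].
(* [h] turns a chord so that its end on the closed component comes first. *)
pose h x : R * R := if inside x.1 then x else (x.2, x.1).
have bijh : set_bij S (component_crossings D d) h.
  split.
  - move=> [s t] [[/= st e] v i]; have sn : s <> t by apply/eqP; rewrite lt_eqF.
    rewrite /h /=; case: ifPn => hs; move: i.
      rewrite hs /=; case ht: (inside t) => // _.
      by split => //; apply: (insideP s) => //; rewrite ht.
    rewrite (negbTE hs) /=; case ht: (inside t) => // _.
    split=> //=; first by apply: (insideP t) => //; exact: nesym.
    by rewrite (info_sym sn e); case: (info D s t) v.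
  - move=> [s t] [s' t']; rewrite !inE => -[[/= st e] v i] [[/= st' e'] v' i'].
    rewrite /h /=; case: ifP => hs; case: ifP => hs' // -[] ? ?; subst; last by [].
      by have := lt_trans st st'; rewrite ltxx.
    by have := lt_trans st st'; rewrite ltxx.
  - move=> [s t] [/= cs lt e v].
    have it : inside t = false.
      by rewrite /inside; apply/negP => /andP[? ?]; case: lt => ?; lra.
    have st : s <> t by move=> E; move: it; rewrite -E /inside cs.
    have is_ : inside s by [].
    case: (ltP s t) => hst.
      by exists (s, t); rewrite /h /= ?is_ //; split; rewrite //= is_ it.
    have ts : t < s by rewrite lt_neqAle hst andbT; apply/eqP; exact: nesym.
    exists (t, s); rewrite /h /= ?it //; split; rewrite //= ?is_ ?it //.
    by rewrite (info_sym st e); case: (info D s t) v.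
transitivity (chord_sum S D d); last first.
  apply: fsbig_widen => [x []//|[s t] [[/= st e] nS] /=].
  rewrite /chord_sign /between -/(inside s) -/(inside t).
  have [->|i] := eqVneq (inside s) (inside t); first by rewrite subrr mulr0.
  by case v: (info D s t); rewrite ?mul0r //; exfalso; apply: nS; split;
    rewrite //= v.
rewrite /intersection_index (reindex_fsbig _ _ _ _ bijh).
apply: eq_fsbigr => -[s t]; rewrite inE => -[[/= st e] v i].
rewrite chord_sign_classical // /between /h /= -/(inside s) -/(inside t).
(* Where [h] swaps the ends, the difference of indicators is -1, which matches the antisymmetry of
   the tangent sign. *)
move: i; case: (inside s); case: (inside t) => //= _; rewrite ?subr0 ?mulr1 //.
by rewrite sub0r mulrN1 tangent_signC.
Qed.

Definition crossing_term fr D d : {poly int} :=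
  crossing_sign D d.1 d.2 *:
    crossing_weight fr (chord_sum (double_points (curve D)) D d).

(** Virtual double points have crossing sign 0, so they may be included in the sum. *)
Lemma diagram_polynomialE fr D :
  diagram_polynomial fr D =
  \sum_(d \in double_points (curve D)) crossing_term fr D d.
Proof.
transitivity (\sum_(d \in classical_crossings D) crossing_term fr D d); last first.
  apply: fsbig_widen => [d []//|d [dd nc] /=].
  rewrite /crossing_term /crossing_sign.
  by case v: (info D d.1 d.2); rewrite ?scale0r //; exfalso; apply: nc; split;
    rewrite //= v.
by apply: eq_fsbigr => d; rewrite inE => -[dd _]; rewrite intersection_indexE.
Qed.

Lemma itv_side (a b s t u : R) : u \notin `[a, b] ->
  s \in `[a, b] -> t \in `[a, b] ->
  ((s < u) = (t < u)) * ((u < s) = (u < t)).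
Proof.
rewrite !in_itv /= negb_and -!ltNge => nu /andP[? ?] /andP[? ?].
by split; apply/idP/idP => ?; move: nu => /orP[] ?; lra.
Qed.

Lemma between_itv d a b s t : d.1 \notin `[a, b] -> d.2 \notin `[a, b] ->
  s \in `[a, b] -> t \in `[a, b] -> between d s = between d t.
Proof.
by move=> d1 d2 si ti; rewrite /between !(itv_side d1 si ti) !(itv_side d2 si ti).
Qed.

End ChordIndex.

(** * Diagrams that agree outside a disc *)

Section LocalChange.
Context {R : realType}.
Variables (fr : framing) (U : set (R * R)) (A : set R) (D D' : diagram R).
Hypothesis closedA : closed A.
Hypothesis changeA : local_change U A D D'.
Implicit Types (s t u : R) (d x : R * R).

Let outside : set (R * R) :=
  [set d | [/\ double_points (curve D) d, ~ A d.1 & ~ A d.2]].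

Let curve_eq t : ~ A t -> curve D' t = curve D t.
Proof. by case: changeA => _ _ h _ /h[]. Qed.

Let A_in t : A t -> U (curve D t) /\ U (curve D' t).
Proof. by case: changeA => _ h _ _ /h. Qed.

Let A_out t : ~ A t -> ~ U (curve D t).
Proof. by case: changeA => _ _ h _ /h[]. Qed.

(** Since [A] is closed, the two curves agree on a neighbourhood of [t]. *)
Lemma local_change_velocity t : ~ A t -> velocity D' t = velocity D t.
Proof.
move=> At; rewrite /velocity !derive1E; apply: near_eq_derive.
have : nbhs t (~` A) by apply: open_nbhs_nbhs; split=> //; exact: closed_openC.
by apply: filterS => u; exact: curve_eq.
Qed.

Lemma local_change_tangent_sign s t : ~ A s -> ~ A t ->
  tangent_sign D' s t = tangent_sign D s t.
Proof. by move=> As At; rewrite /tangent_sign !local_change_velocity. Qed.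

(** The curve lies in [U] exactly at the parameters in [A], so no chord joins [A] to its
    complement. *)
Lemma local_change_double_points :
  double_points (curve D) = outside `|` double_points_on A D.
Proof.
rewrite predeqE => -[s t]; split=> [[st e]|[[]|[]]//].
have [As|As] := pselect (A s); have [At|At] := pselect (A t).
- by right.
- by case: (A_out At); move: e => /= <-; case: (A_in As).
- by case: (A_out As); move: e => /= ->; case: (A_in At).
- by left.
Qed.

Lemma local_change_double_points' :
  double_points (curve D') = outside `|` double_points_on A D'.
Proof.
rewrite predeqE => -[s t]; split=> [[/= st e]|[[[/= st e] As At]|[]//]]; last first.
  by split=> //=; rewrite !curve_eq.
have [As|As] := pselect (A s); have [At|At] := pselect (A t).
- by right.
- by case: (A_out At); rewrite -curve_eq // -e; case: (A_in As).
- by case: (A_out As); rewrite -curve_eq // e; case: (A_in At).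
- by left; split=> //; split=> //=; rewrite -!curve_eq.
Qed.

Let outside_finite : finite_set outside.
Proof. by apply: sub_finite_set (curve_finite D) => d []. Qed.

Let outside_chord_sign d : outside d ->
  chord_sign D' d.1 d.2 = chord_sign D d.1 d.2 /\
  crossing_sign D' d.1 d.2 = crossing_sign D d.1 d.2.
Proof.
move=> [[st e] As At]; have sn : d.1 <> d.2 by apply/eqP; rewrite lt_eqF.
have ie : info D' d.1 d.2 = info D d.1 d.2.
  by case: changeA => _ _ _; apply.
by rewrite /chord_sign /crossing_sign ie !local_change_tangent_sign.
Qed.

Let inside_finite (E : diagram R) : finite_set (double_points_on A E).
Proof. by apply: sub_finite_set (curve_finite E) => d []. Qed.

Let fsum_split (V : nmodType) (E : diagram R) (F : R * R -> V) :
  \sum_(d \in outside `|` double_points_on A E) F d =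
  \sum_(d \in outside) F d + \sum_(d \in double_points_on A E) F d.
Proof. by apply: fsbigU0 => // d [[_ nA _] [_ Ad _]]. Qed.

(** Outer chords keep their sign, and their ends lie off [A], where the indicators agree. Allowing
    [d] and [d'] to differ covers an outer chord, a corner before and after a triangle move and,
    with both diagrams equal, the two crossings of a bigon. *)
Lemma local_change_chord_sum d d' :
  (forall u, ~ A u -> between d' u = between d u) ->
  chord_sum (double_points_on A D') D' d' = chord_sum (double_points_on A D) D d ->
  chord_sum (double_points (curve D')) D' d' =
  chord_sum (double_points (curve D)) D d.
Proof.
move=> bE; rewrite /chord_sum local_change_double_points local_change_double_points'.
rewrite !fsum_split => ->; congr (_ + _).
apply: eq_fsbigr => x; rewrite inE => ox; rewrite (outside_chord_sign ox).1.
by case: ox => _ x1 x2; rewrite !bE.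
Qed.

(** Reduces a move to two checks inside the disc: its chords act equally on every outer index, and
    its own crossings have the same total term. *)
Lemma local_change_polynomial :
  (forall d, ~ A d.1 -> ~ A d.2 ->
     chord_sum (double_points_on A D') D' d = chord_sum (double_points_on A D) D d) ->
  \sum_(d \in double_points_on A D') crossing_term fr D' d =
  \sum_(d \in double_points_on A D) crossing_term fr D d ->
  diagram_polynomial fr D' = diagram_polynomial fr D.
Proof.
move=> sumE inE'; rewrite !diagram_polynomialE.
rewrite [in LHS]local_change_double_points' [in RHS]local_change_double_points.
rewrite !fsum_split inE'; congr (_ + _).
apply: eq_fsbigr => d; rewrite inE => od.
rewrite /crossing_term (outside_chord_sign od).2; congr (_ *: crossing_weight _ _).
by case: od => _ d1 d2; apply: local_change_chord_sum => //; exact: sumE.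
Qed.

End LocalChange.

(** * Reidemeister moves 1 and 2, classical, framed and virtual *)

Section ArcMoves.
Context {R : realType}.
Implicit Types (D : diagram R) (d : R * R).

(** The indicator of [d] is constant on an arc containing no end of [d]. *)
Lemma chord_sum_arc d a b D :
  d.1 \notin `[a, b] -> d.2 \notin `[a, b] ->
  chord_sum (double_points_on `[a, b] D) D d = 0.
Proof.
move=> d1 d2; apply: fsbig1 => x [_ x1 x2].
by rewrite (between_itv d1 d2 x1 x2) subrr mulr0.
Qed.

(* The closed component cut off by a kink meets nothing. *)
Lemma chord_sum_kink A D d : (forall u, d.1 < u < d.2 -> A u) ->
  (forall x, double_points_on A D x -> ~~ (d.1 < x.1 < d.2) /\ ~~ (d.1 < x.2 < d.2)) ->
  (forall u v, A u -> curve D u = curve D v -> A v) ->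
  chord_sum (double_points (curve D)) D d = 0.
Proof.
move=> dA hx hA; apply: fsbig1 => -[u v] [/= uv e]; rewrite /between.
case hu: (d.1 < u < d.2); case hv: (d.1 < v < d.2); rewrite ?subrr ?mulr0 //.
  have Au := dA _ hu; have Av := hA _ _ Au e.
  by have [|] := hx (u, v); rewrite /= ?hu.
have Av := dA _ hv; have Au := hA _ _ Av (esym e).
by have [|] := hx (u, v); rewrite /= ?hv.
Qed.

Lemma local_change_inside U A D D' u v : local_change U A D D' ->
  A u -> curve D' u = curve D' v -> A v.
Proof.
move=> [_ i o _] Au e; have [//|/o[nU ev]] := pselect (A v).
by case: nU; rewrite -ev -e; case: (i u Au).
Qed.

(** A kink has index 0. Its term vanishes because its sign is 0 if it is virtual, and because its
    weight is ['X^0 - 1] in the unframed case. *)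
Lemma kink_move_polynomial fr (allowed : strand_info -> Prop) D D' :
  (forall o, allowed o -> o = Virtual \/ fr = Unframed) ->
  kink_move allowed D D' -> diagram_polynomial fr D' = diagram_polynomial fr D.
Proof.
move=> hfr [U [a [b [s [t [lc d0 d1 [as_ tb] al]]]]]].
have [[/= st e] As At] : double_points_on `[a, b] D' (s, t) by rewrite d1.
apply: (local_change_polynomial _ lc) => [|d /negP h1 /negP h2|].
- exact: interval_closed.
- by rewrite !chord_sum_arc.
rewrite d0 d1 fsbig_set0 fsbig_set1 /crossing_term (@chord_sum_kink [set` `[a, b]]).
- case: (hfr _ al) => [v|->]; last by rewrite /= expr0 subrr scaler0.
  by rewrite /crossing_sign /= v scale0r.
- by move=> u /= /andP[? ?]; rewrite in_itv /=; apply/andP; split; lra.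
- by rewrite d1 => x -> /=; rewrite !ltxx andbF.
- by move=> u v; exact: local_change_inside lc.
Qed.

(** Both kinks have index 0, hence framed weight 1, and their opposite signs cancel. *)
Lemma double_kink_move_polynomial D D' :
  double_kink_move D D' -> diagram_polynomial Framed D' = diagram_polynomial Framed D.
Proof.
move=> [U [a [b [s1 [t1 [s2 [t2 [lc d0 d2 [as1 t1s2 t2b] [_ _ csE]]]]]]]]].
have [[/= st1 _] _ _] : double_points_on `[a, b] D' (s1, t1) by rewrite d2; left.
have [[/= st2 _] _ _] : double_points_on `[a, b] D' (s2, t2) by rewrite d2; right.
apply: (local_change_polynomial _ lc) => [|d /negP h1 /negP h2|].
- exact: interval_closed.
- by rewrite !chord_sum_arc.
rewrite d0 d2 fsbig_set0 fsbigU0 ?finite_set1 //; last first.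
  by move=> x [/= -> []]; lra.
have hA u v : [set` `[a, b]] u -> curve D' u = curve D' v -> [set` `[a, b]] v.
  exact: local_change_inside lc.
have i1 : chord_sum (double_points (curve D')) D' (s1, t1) = 0.
  apply: (chord_sum_kink _ _ hA) => [u /= /andP[? ?]|x].
    by rewrite in_itv /=; apply/andP; split; lra.
  by rewrite d2 => -[] -> /=; split; apply/negP => /andP[]; lra.
have i2 : chord_sum (double_points (curve D')) D' (s2, t2) = 0.
  apply: (chord_sum_kink _ _ hA) => [u /= /andP[? ?]|x].
    by rewrite in_itv /=; apply/andP; split; lra.
  by rewrite d2 => -[] -> /=; split; apply/negP => /andP[]; lra.
by rewrite !fsbig_set1 /crossing_term i1 i2 /= csE scaleNr addNr.
Qed.

(** The two new chords have opposite signs and their ends lie on the same two arcs, so they cancel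
    in every outer index. Their own indices are equal, so their terms cancel too. *)
Lemma bigon_move_polynomial fr (allowed : strand_info -> Prop) D D' :
  bigon_move allowed D D' -> diagram_polynomial fr D' = diagram_polynomial fr D.
Proof.
move=> [U [a1 [b1 [a2 [b2 [s1 [s2 [t1 [t2 [[b1a2 lc] d0 d2 hst [ie _ csE]]]]]]]]]]].
case: hst => a1s1 s12 s2b1 [/andP[a2t1 t1b2] /andP[a2t2 t2b2]].
set A := _ `|` _ in lc d0 d2.
(* With equal decorations, both crossing signs equal the chord signs up to one common factor. *)
have csgE : chord_sign D' s1 t1 = - chord_sign D' s2 t2.
  move: csE; rewrite /chord_sign /crossing_sign ie.
  case: (info D' s2 t2) => [e|e|_]; [exact: e| |by rewrite oppr0].
  by rewrite (tangent_signC D' t1) (tangent_signC D' t2) e.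
have ne : (s1, t1) <> (s2, t2) by case; lra.
have sum2 (V : nmodType) (F : R * R -> V) :
    \sum_(d \in double_points_on A D') F d = F (s1, t1) + F (s2, t2).
  rewrite d2 fsbigU0 ?finite_set1 ?fsbig_set1 //.
  by move=> x [/= -> ] /=.
have i1 : s1 \in `[a1, b1] by rewrite in_itv /=; apply/andP; split; lra.
have i2 : s2 \in `[a1, b1] by rewrite in_itv /=; apply/andP; split; lra.
have j1 : t1 \in `[a2, b2] by rewrite in_itv /=; apply/andP; split; lra.
have j2 : t2 \in `[a2, b2] by rewrite in_itv /=; apply/andP; split; lra.
apply: (local_change_polynomial _ lc) => [|d h1 h2|].
- by apply: closedU; exact: interval_closed.
- rewrite d0 /chord_sum fsbig_set0 sum2 /= csgE.
  have n1 : d.1 \notin `[a1, b1] by apply/negP => h; apply: h1; left.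
  have n2 : d.1 \notin `[a2, b2] by apply/negP => h; apply: h1; right.
  have n3 : d.2 \notin `[a1, b1] by apply/negP => h; apply: h2; left.
  have n4 : d.2 \notin `[a2, b2] by apply/negP => h; apply: h2; right.
  rewrite (between_itv n1 n3 i1 i2) (between_itv n2 n4 j1 j2).
  by rewrite mulNr addNr.
rewrite d0 fsbig_set0 sum2 /crossing_term /= csE scaleNr.
suff -> : chord_sum (double_points (curve D')) D' (s1, t1) =
          chord_sum (double_points (curve D')) D' (s2, t2) by rewrite addNr.
(* The diagram is compared with itself, in order to compare the indices of two of its chords. *)
have lc' : local_change U A D' D'.
  case: lc => sm i o _; split=> // u Au; first by have [_] := i u Au.
  by have [h e] := o u Au; rewrite e.
apply: (local_change_chord_sum _ lc').
- by apply: closedU; exact: interval_closed.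
- move=> u nA; rewrite /between /=; congr ((nat_of_bool _)%:R).
  have n1 : u \notin `[a1, b1] by apply/negP => h; apply: nA; left.
  have n2 : u \notin `[a2, b2] by apply/negP => h; apply: nA; right.
  by rewrite (itv_side n1 i1 i2) (itv_side n2 j1 j2).
rewrite /chord_sum !sum2 csgE /between /= !ltxx !andbF /=.
have -> : s1 < s2 by [].
have -> : s2 < t1 = true by lra.
have -> : s1 < t2 = true by lra.
have -> : s2 < s1 = false by apply/negbTE; rewrite -leNgt; lra.
(* For [t1 < t2] the chords interlace, and the opposite signs make up for the opposite sides on
   which they cross each other. For [t2 < t1] they are nested and contribute nothing. Equality would
   be a triple point. *)
case: (ltgtP t1 t2) => [_|_|tt] /=; [ring|ring|].
have [[_ /= e1] _ _] : double_points_on A D' (s1, t1) by rewrite d2; left.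
have [[_ /= e2] _ _] : double_points_on A D' (s2, t2) by rewrite d2; right.
case: (@curve_no_triple _ D' s1 s2 t1) => //; first by lra.
by rewrite e1 e2 tt.
Qed.

End ArcMoves.

(** * Chain rules, orientation signs and planar isotopy *)

Section Transport.
Context {R : realType}.
Implicit Types (D E : diagram R) (d : R * R) (P Q : set (R * R)).

Lemma chord_sum_reindex k P Q D E d d' : set_bij P Q k ->
  (forall x, P x -> chord_sign D x.1 x.2 = chord_sign E (k x).1 (k x).2) ->
  (forall x, P x -> between d x.1 = between d' (k x).1 /\
                    between d x.2 = between d' (k x).2) ->
  chord_sum P D d = chord_sum Q E d'.
Proof.
move=> bk hc hb; rewrite /chord_sum (reindex_fsbig _ _ _ _ bk).
by apply: eq_fsbigr => x; rewrite inE => Px; have [-> ->] := hb x Px; rewrite hc.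
Qed.

Lemma derive1_gt0_mono (h : R -> R) a b : (forall t, derivable h t 1) ->
  (forall t, t \in `[a, b] -> 0 < derive1 h t) ->
  {in `[a, b] &, {mono h : s t / s < t}}.
Proof.
move=> dh h0.
have incr s t : s \in `[a, b] -> t \in `[a, b] -> s < t -> h s < h t.
  move=> si ti st; apply: (@gtr0_derive1_incr _ h a b) => //.
  - by move=> x /subset_itv_oo_cc; exact: h0.
  - apply: continuous_subspaceT => x.
    by apply: differentiable_continuous; apply/derivable1_diffP.
  - by move: si; rewrite in_itv => /andP[].
  - by move: ti; rewrite in_itv => /andP[].
move=> s t si ti; apply/idP/idP => [hst|]; last exact: incr.
rewrite ltNge le_eqVlt; apply/norP; split.
  by apply/eqP => e; move: hst; rewrite e ltxx.
by apply/negP => /(incr _ _ ti si) /(lt_trans hst); rewrite ltxx.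
Qed.

Lemma derive1_comp_diff (V W : normedModType R) (F : V -> W) (g : R -> V) t :
  differentiable F (g t) -> derivable g t 1 ->
  derive1 (F \o g) t = 'd F (g t) (derive1 g t).
Proof.
move=> dF /derivable1_diffP dg.
rewrite derive1E'; last exact: differentiable_comp.
by rewrite derive1E' // diff_comp.
Qed.

Lemma derive1_comp_param (W : normedModType R) (g : R -> W) (h : R -> R) t :
  derivable g (h t) 1 -> derivable h t 1 ->
  derive1 (g \o h) t = derive1 h t *: derive1 g (h t).
Proof.
move=> /derivable1_diffP dg dh.
by rewrite derive1_comp_diff // diff1E.
Qed.

Lemma derive1_comp_affine (V W : normedModType R) (F : V -> W) (p v : V)
    (h : R -> R) t :
  differentiable F (p + h t *: v) -> derivable h t 1 ->
  derive1 (fun t => F (p + h t *: v)) t = 'd F (p + h t *: v) (derive1 h t *: v).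
Proof.
move=> dF /derivable1_diffP dh; have dhv := differentiableZl v dh.
have dl : differentiable (fun t => p + h t *: v) t by apply: differentiableD.
rewrite (@derive1_comp_diff _ _ F (fun t => p + h t *: v)) //; last first.
  exact/derivable1_diffP.
rewrite (derive1E' dl) diffD // diff_cst /= add0r diffZl //.
by rewrite diff1E // scale1r.
Qed.

(** Multiplicativity of the determinant; the first factor on the right is the determinant of [L]. *)
Lemma det2_linear (L : R * R -> R * R) u v :
  (forall (k : R) x y, L (k *: x + y) = k *: L x + L y) ->
  det2 (L u) (L v) = det2 (L (1, 0)) (L (0, 1)) * det2 u v.
Proof.
move=> linL.
have L0 : L 0 = 0 by have := linL (-1) 0 0; rewrite scaler0 addr0 scaleN1r addNr.
have E w : L w = w.1 *: L (1, 0) + w.2 *: L (0, 1).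
  rewrite -[w.2 *: _]addr0 -L0 -!linL; congr (L _); case: w => x y /=.
  by congr pair => /=; rewrite /GRing.scale /= !(mulr1, mulr0, addr0, add0r).
by rewrite (E u) (E v) /det2 /= /GRing.scale /=; ring.
Qed.

Lemma det2Zl (k : R) u v : det2 (k *: u) v = k * det2 u v.
Proof. by rewrite /det2 /= /GRing.scale /=; ring. Qed.

Lemma det2Zr (k : R) u v : det2 u (k *: v) = k * det2 u v.
Proof. by rewrite /det2 /= /GRing.scale /=; ring. Qed.

Lemma smooth_differentiable (V W : normedModType R) (f : V -> W) x :
  smooth f -> differentiable f x.
Proof. by move=> /(_ 1) []. Qed.

Lemma smooth_derivable (W : normedModType R) (f : R -> W) x :
  smooth f -> derivable f x 1.
Proof. by move=> sf; apply/derivable1_diffP; exact: smooth_differentiable. Qed.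

(** The differential has positive determinant, and positive rescaling of the two vectors does not
    affect the sign. *)
Lemma sgz_det2_diffeo (F : R * R -> R * R) p (k l : R) u v : plane_diffeo F -> 0 < k -> 0 < l ->
  sgz (det2 ('d F p (k *: u)) ('d F p (l *: v))) = sgz (det2 u v).
Proof.
move=> [sF _ posF] k0 l0; rewrite det2_linear; last by move=> c x y; exact: linearP.
rewrite det2Zl det2Zr !sgzM.
have dFp : differentiable F p by exact: smooth_differentiable.
have := posF p; rewrite !deriveE // => /gtr0_sgz ->.
rewrite (gtr0_sgz k0) (gtr0_sgz l0).
by rewrite !mul1r.
Qed.

(** The increasing bijection [h] matches the chords together with the order of their ends, and the
    orientation-preserving [F] keeps their signs. *)
Lemma planar_isotopy_polynomial fr D D' :
  planar_isotopy D D' -> diagram_polynomial fr D' = diagram_polynomial fr D.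
Proof.
move=> [F [h [dF rh cE iE]]].
have [sF bF _] := dF; have [sh bh h0] := rh.
have hmono : {mono h : s t / s < t}.
  (* The interval spanned by the two parameters, on which the derivative test applies. *)
  move=> s t; pose a := Num.min s t; pose b := Num.max s t.
  apply: (@derive1_gt0_mono h a b) => [u|u _|/=|/=]; first exact: smooth_derivable.
  - exact: h0.
  - by rewrite in_itv /= ge_min le_max !lexx.
  - by rewrite in_itv /= ge_min le_max !lexx !orbT.
have vE t : velocity D' t = 'd F (curve D (h t)) (derive1 h t *: velocity D (h t)).
  rewrite /velocity (_ : curve D' = F \o (curve D \o h)); last by apply/funext => u; rewrite cE.
  have dc : derivable (curve D) (h t) 1 by exact: smooth_derivable (curve_smooth D).
  have dh : derivable h t 1 by exact: smooth_derivable.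
  rewrite derive1_comp_diff; [|exact: smooth_differentiable|].
    by rewrite derive1_comp_param.
  by apply/derivable1_diffP; apply: differentiable_comp; apply/derivable1_diffP.
have tsE s t : curve D (h s) = curve D (h t) ->
    tangent_sign D' s t = tangent_sign D (h s) (h t).
  by move=> e; rewrite /tangent_sign !vE -e sgz_det2_diffeo.
pose k d : R * R := (h d.1, h d.2).
have eqE s t : (curve D' s = curve D' t) <-> (curve D (h s) = curve D (h t)).
  by rewrite !cE; split=> [/(bij_inj bF)|->].
have bk : set_bij (double_points (curve D')) (double_points (curve D)) k.
  split.
  - by move=> [s t] [/= st /eqE e]; split; rewrite //= hmono.
  - by move=> [s t] [s' t'] _ _ [] /(bij_inj bh) -> /(bij_inj bh) ->.
  - case: bh => g hg gh [s t] [/= st e]; exists (g s, g t); last by rewrite /k /= !gh.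
    by split=> /=; [rewrite -hmono !gh|apply/eqE; rewrite !gh].
rewrite !diagram_polynomialE (reindex_fsbig _ _ _ _ bk).
have sE d : double_points (curve D') d ->
    chord_sign D' d.1 d.2 = chord_sign D (k d).1 (k d).2 /\
    crossing_sign D' d.1 d.2 = crossing_sign D (k d).1 (k d).2.
  move=> [st e]; have ne : d.1 <> d.2 by apply/eqP; rewrite lt_eqF.
  rewrite /chord_sign /crossing_sign (iE _ _ ne e).
  by move/eqE: e => e; rewrite !tsE.
apply: eq_fsbigr => d; rewrite inE => dd.
rewrite /crossing_term (sE d dd).2; congr (_ *: crossing_weight _ _).
apply: (chord_sum_reindex bk) => [x xd|x _]; first by rewrite (sE x xd).1.
by rewrite /between /= !hmono.
Qed.

End Transport.

(** * Additivity under concatenation *)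

Section Concatenation.
Context {R : realType}.
Implicit Types (D : diagram R) (d : R * R).

(** Past [r] the curve is on the axis with abscissa its parameter. Parameters in [[-r, r]] give
    points of the disc and the others distinct axis points, so a double point can only use
    parameters in [[-r, r]]. *)
Lemma axis_outside_right (r : R) D s t : 0 < r -> axis_outside r (curve D) ->
  s < t -> curve D s = curve D t -> t <= r /\ - r <= s.
Proof.
move=> r0 ax st e; have [out _] := ax; have b := axis_bound _ r0 ax.
split; rewrite leNgt; apply/negP => h.
  move: e; rewrite (out t) => [e|]; last by rewrite gtr0_norm; lra.
  have [sr|sr] := leP `|s| r; last by move: e; rewrite out // => -[]; lra.
  have : (curve D s).1 <= r by apply: (b s).1; exact: le_trans (ler_norm _) sr.
  by rewrite e /=; lra.
move: e; rewrite (out s) => [e|]; last by rewrite ltr0_norm; lra.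
have [tr|tr] := leP `|t| r; last by move: e; rewrite out // => -[]; lra.
have : - r <= (curve D t).1 by apply: (b t).2; move: tr; rewrite ler_norml => /andP[].
by rewrite -e /=; lra.
Qed.

(* A translate of [E] occupying the open set [I] of parameters of [D], where it
   carries the double points [P]. *)
Lemma translate_polynomial fr D E (P : set (R * R)) (I : set R) (c : R) (w : R * R) :
  open I -> (forall t, I t -> curve D t = curve E (t + c) + w) ->
  (forall s t, I s -> I t -> s <> t -> curve D s = curve D t ->
     info D s t = info E (s + c) (t + c)) ->
  P `<=` double_points (curve D) -> (forall d, P d -> I d.1 /\ I d.2) ->
  (forall d, double_points (curve E) d -> P (d.1 - c, d.2 - c)) ->
  (forall d, P d -> chord_sum (double_points (curve D)) D d = chord_sum P D d) ->
  \sum_(d \in P) crossing_term fr D d = diagram_polynomial fr E.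
Proof.
move=> oI cE iE PD PI EP sumE.
have vE t : I t -> velocity D t = velocity E (t + c).
  move=> It; rewrite /velocity !derive1E -(derive_translate (curve E) c w).
  apply: near_eq_derive; have : nbhs t I by exact: open_nbhs_nbhs.
  by apply: filterS => u; exact: cE.
pose k d : R * R := (d.1 + c, d.2 + c).
have bk : set_bij P (double_points (curve E)) k.
  split.
  - move=> d Pd; have [st e] := PD _ Pd; have [I1 I2] := PI _ Pd.
    by split; rewrite /= ?ltrD2r //; apply: (addIr w); rewrite -!cE.
  - by move=> [s t] [s' t'] _ _ [] /addIr -> /addIr ->.
  - move=> d dE; exists (d.1 - c, d.2 - c); first exact: EP.
    by rewrite /k /= !subrK -surjective_pairing.
have sE d : P d -> chord_sign D d.1 d.2 = chord_sign E (k d).1 (k d).2 /\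
    crossing_sign D d.1 d.2 = crossing_sign E (k d).1 (k d).2.
  move=> Pd; have [st e] := PD _ Pd; have [I1 I2] := PI _ Pd.
  have ne : d.1 <> d.2 by apply/eqP; rewrite lt_eqF.
  by rewrite /chord_sign /crossing_sign /tangent_sign !vE // iE.
rewrite diagram_polynomialE (reindex_fsbig _ _ _ _ bk).
apply: eq_fsbigr => d; rewrite inE => Pd.
rewrite /crossing_term (sE d Pd).2 sumE //; congr (_ *: crossing_weight _ _).
apply: (chord_sum_reindex bk) => [x Px|x _]; first by rewrite (sE x Px).1.
by rewrite /between /= !ltrD2r.
Qed.

Lemma concatenation_polynomial fr D1 D2 D : concatenation D1 D2 D ->
  diagram_polynomial fr D = diagram_polynomial fr D1 + diagram_polynomial fr D2.
Proof.
move=> [r1 [r2 [a [b [[[/andP[r10 r1a] ax1] [/andP[r20 r2b] ax2]] c1 c2 i1 i2]]]]].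
(* The translation by [a > r1] puts the first half strictly to the left of the vertical axis;
   symmetrically for the second half. *)
have neg t : t < 0 -> (curve D t).1 < 0.
  move=> t0; rewrite c1 ?ltW //=.
  have [h|h] := leP (t + a) r1; first by have := (axis_bound (t + a) r10 ax1).1 h; lra.
  by rewrite ax1.1 /=; [lra|rewrite gtr0_norm; lra].
have pos t : 0 < t -> 0 < (curve D t).1.
  move=> t0; rewrite c2 ?ltW //=.
  have [h|h] := leP (- r2) (t - b); first by have := (axis_bound (t - b) r20 ax2).2 h; lra.
  by rewrite ax2.1 /=; [lra|rewrite ltr0_norm; lra].
have zero : (curve D 0).1 = 0.
  rewrite c1 //= add0r ax1.1 /=; first by rewrite subrr.
  by rewrite gtr0_norm; lra.
have sep d : double_points (curve D) d -> d.2 < 0 \/ 0 < d.1.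
  move=> [st e]; have [t0|t0|t0] := ltgtP d.2 0; first by left.
    have [s0|s0|s0] := ltgtP d.1 0; last 1 first.
    - by have := pos _ t0; rewrite -e s0 zero; lra.
    - by have := pos _ t0; have := neg _ s0; rewrite e; lra.
    - by right.
  by have := neg d.1; rewrite e t0 zero => /(_ _); lra.
pose L := [set d | double_points (curve D) d /\ d.2 < 0].
pose P := [set d | double_points (curve D) d /\ 0 < d.1].
have fL : finite_set L by apply: sub_finite_set (curve_finite D) => d [].
have fP : finite_set P by apply: sub_finite_set (curve_finite D) => d [].
have LP : double_points (curve D) = L `|` P.
  rewrite predeqE => d; split=> [dd|[[]|[]]//].
  by case: (sep d dd); [left|right].
have LP0 : L `&` P `<=` set0 by move=> d [[[st _] ?] [_ ?]]; move: st => /=; lra.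
have split_sum d :
    chord_sum (double_points (curve D)) D d = chord_sum L D d + chord_sum P D d.
  by rewrite /chord_sum LP fsbigU0.
(* A chord of the right half has both ends beyond [d.2], hence zero difference of indicators. *)
have sumL d : L d -> chord_sum (double_points (curve D)) D d = chord_sum L D d.
  move=> [_ d0]; rewrite split_sum [chord_sum P D d]fsbig1 ?addr0 //.
  move=> x [[xl _] x0]; rewrite /between.
  have -> : x.1 < d.2 = false by apply/negbTE; rewrite -leNgt; lra.
  have -> : x.2 < d.2 = false by apply/negbTE; rewrite -leNgt; lra.
  by rewrite !andbF subrr mulr0.
have sumP d : P d -> chord_sum (double_points (curve D)) D d = chord_sum P D d.
  move=> [_ d0]; rewrite split_sum [chord_sum L D d]fsbig1 ?add0r //.
  move=> x [[xl _] x0]; rewrite /between.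
  have -> : d.1 < x.1 = false by apply/negbTE; rewrite -leNgt; lra.
  have -> : d.1 < x.2 = false by apply/negbTE; rewrite -leNgt; lra.
  by rewrite subrr mulr0.
rewrite diagram_polynomialE LP fsbigU0 //; congr (_ + _).
- apply: (@translate_polynomial fr D D1 L [set t | t < 0] a (- (a, 0))) => //.
  + by move=> t /= t0; rewrite c1 // ltW.
  + by move=> s t /= s0 t0 ne e; apply: i1 => //; exact: ltW.
  + by move=> d [].
  + by move=> d [[st _] d2] /=; split=> //; lra.
  (* Every chord of [D1] ends at or before [r1 < a], so its translate stays among negative
     parameters. *)
  + move=> d [st e]; have [h1 h2] := axis_outside_right r10 ax1 st e.
    split=> /=; last by lra.
    by split=> /=; rewrite ?ltrD2r // !c1 ?subrK ?e //; lra.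
- apply: (@translate_polynomial fr D D2 P [set t | 0 < t] (- b) (b, 0)) => //.
  + by move=> t /= t0; rewrite c2 // ltW.
  + by move=> s t /= s0 t0 ne e; apply: i2 => //; exact: ltW.
  + by move=> d [].
  + by move=> d [[st _] d2] /=; split=> //; lra.
  + move=> d [st e]; have [h1 h2] := axis_outside_right r20 ax2 st e.
    split=> /=; last by lra.
    by split=> /=; rewrite ?ltrD2r // !c2 ?opprK ?addrK ?e //; lra.
Qed.

End Concatenation.

(** * Geometry of three straight strands *)

Section Triangle.
Context {R : realType}.
Implicit Types (D : diagram R) (d : R * R) (i j k : 'I_3) (s t u : R).

Lemma ord3_cases i j k l : i != j -> j != k -> i != k -> [\/ l = i, l = j | l = k].
Proof.
case: i => -[|[|[|//]]] ?; case: j => -[|[|[|//]]] ? //; case: k => -[|[|[|//]]] ? //;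
case: l => -[|[|[|//]]] ? // _ _ _;
  by [constructor 1; exact: val_inj|constructor 2; exact: val_inj|constructor 3; exact: val_inj].
Qed.

Lemma ord3_third i j : i != j -> exists k, j != k /\ i != k.
Proof.
case: i => -[|[|[|//]]] ?; case: j => -[|[|[|//]]] ? // _;
by [exists (@Ordinal 3 0 isT) | exists (@Ordinal 3 1 isT) | exists (@Ordinal 3 2 isT)].
Qed.

(** The relation [r] selects one orientation of each pair, as increasing parameters do for chords.
    With [f] symmetric, the sum can be written without knowing which. *)
Lemma fsum_tournament (V : nmodType) (r : rel 'I_3) (f : 'I_3 -> 'I_3 -> V) i j k :
  (forall x y, x != y -> r y x = ~~ r x y) -> (forall x, ~~ r x x) ->
  (forall x y, x != y -> f y x = f x y) ->
  i != j -> j != k -> i != k ->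
  \sum_(x \in [set x : 'I_3 * 'I_3 | r x.1 x.2]) f x.1 x.2 = f i j + f i k + f j k.
Proof.
move=> rC rI fC ij jk ik.
pose g x y : 'I_3 * 'I_3 := if r x y then (x, y) else (y, x).
have gf x y : x != y -> f (g x y).1 (g x y).2 = f x y.
  by move=> xy; rewrite /g; case: ifP => //= _; rewrite fC.
have gr x y : x != y -> r (g x y).1 (g x y).2.
  by move=> xy; rewrite /g; case: ifPn => //= h; rewrite rC.
have gE x y : r x y -> (x, y) = g x y /\ (x, y) = g y x.
  move=> rxy; have xy : x != y by apply/eqP => E; move: rxy; rewrite E (negbTE (rI y)).
  by rewrite /g rxy rC // rxy.
have gij x y z : x != y -> y != z -> x != z -> g x y <> g x z /\ g x y <> g y z /\ g x z <> g y z.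
  rewrite /g => xy yz xz; do 3![case: ifP => _]; do 2?split;
  by move=> [] *; subst; rewrite ?eqxx in xy yz xz.
have [n1 [n2 n3]] := gij i j k ij jk ik.
have -> : [set x : 'I_3 * 'I_3 | r x.1 x.2] = [set g i j; g i k] `|` [set g j k].
  rewrite predeqE => z; split=> [|[[->|->]|->]]; [|exact: gr..].
  case: z => x y /= rxy.
  have xy : x <> y by move=> E; move: rxy; rewrite E (negbTE (rI y)).
  have [e1 e2] := gE _ _ rxy.
  case: (ord3_cases x ij jk ik) => xe; case: (ord3_cases y ij jk ik) => ye;
    rewrite xe ye in e1 e2 xy *; try (by case: xy); tauto.
rewrite !fsbigU0 ?finite_setU //; last 2 first.
- by move=> x [/= -> /n1].
- by move=> x [/= [->|->]] // => [/n2|/n3].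
by rewrite !fsbig_set1 !gf.
Qed.

(** Links the signs of the sides of a triangle to the indicators that occur in an index. *)
Lemma sgzB (x y : R) : sgz (y - x) = (x < y)%R%:R - (y < x)%R%:R :> int.
Proof.
case: (ltgtP x y) => h /=; first by rewrite gtr0_sgz ?subr_gt0 // subr0.
  by rewrite ltr0_sgz ?subr_lt0 // sub0r.
by rewrite h subrr sgz0 subrr.
Qed.

Lemma lines_meet_sub (V : lmodType R) (p q u v : V) (x y x' y' : R) :
  p + x *: u = q + y *: v -> p + x' *: u = q + y' *: v ->
  (x - x') *: u = (y - y') *: v.
Proof.
move=> e e'; have := congr2 (fun w z => w - z) e e'.
by rewrite /= !opprD [LHS]addrACA [RHS]addrACA !subrr !add0r -!scalerBl.
Qed.

Section StraightTriangle.
Variables (F : R * R -> R * R) (a b : 'I_3 -> R) (c : 'I_3 -> 'I_3 -> R) (D : diagram R).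
Hypothesis sep : forall i j, i != j -> b i < a j \/ b j < a i.
Hypothesis straight : straight_triangle F a b c D.

Lemma triangle_order i j s t : i != j -> s \in `[a i, b i] -> t \in `[a j, b j] ->
  (s < t) = (a i < a j).
Proof.
move=> ij; rewrite !in_itv /= => /andP[? ?] /andP[? ?].
by case: (sep ij) => ?; apply/idP/idP => ?; lra.
Qed.

Lemma triangle_corner i j : i != j -> a i < c i j < b i /\ c i j \in `[a i, b i].
Proof.
case: straight => _ _ /[apply] -[/andP[h1 h2] _].
by rewrite h1 h2 in_itv /= !ltW.
Qed.

Lemma triangle_corner_eq i j : i != j -> curve D (c i j) = curve D (c j i).
Proof. by case: straight => _ _ /[apply] -[]. Qed.

Lemma triangle_corner_neq i j : i != j -> c i j <> c j i.
Proof.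
move=> ij E; have [/andP[? ?] _] := triangle_corner ij.
have ji : j != i by rewrite eq_sym.
have [/andP[? ?] _] := triangle_corner ji.
by case: (sep ij) => ?; lra.
Qed.

Lemma tangent_sign_neq0 s t : s <> t -> curve D s = curve D t -> tangent_sign D s t != 0.
Proof.
move=> /eqP; rewrite neq_lt /tangent_sign sgz_eq0 => /orP[] st e.
  exact: curve_transverse.
by rewrite det2C oppr_eq0; apply: curve_transverse.
Qed.

(* The linear algebra of three lines, the data of the chart being forgotten. *)
Lemma triangle_lines : exists (p v : 'I_3 -> R * R) (h : 'I_3 -> R -> R),
  [/\ forall i s t, s \in `[a i, b i] -> t \in `[a i, b i] ->
        (h i s < h i t) = (s < t),
      forall i j s t, s \in `[a i, b i] -> t \in `[a j, b j] ->
        curve D s = curve D t -> p i + h i s *: v i = p j + h j t *: v j,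
      forall i j, i != j -> det2 (v i) (v j) != 0 &
      forall i j, i != j ->
        tangent_sign D (c i j) (c j i) = sgz (det2 (v i) (v j))].
Proof.
case: straight => dF [p [v [h hE]]] _; have [sF bF _] := dF.
have cE i t : t \in `[a i, b i] -> curve D t = F (p i + h i t *: v i).
  by move=> ti; case: (hE i) => _ /(_ _ ti)[].
have h0 i t : t \in `[a i, b i] -> 0 < derive1 (h i) t.
  by move=> ti; case: (hE i) => _ /(_ _ ti)[].
have sh i t : derivable (h i) t 1 by apply: smooth_derivable; case: (hE i).
have eqE i j s t : s \in `[a i, b i] -> t \in `[a j, b j] ->
    curve D s = curve D t -> p i + h i s *: v i = p j + h j t *: v j.
  by move=> si tj; rewrite (cE i) // (cE j) // => /(bij_inj bF).
have vE i t : a i < t < b i ->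
    velocity D t = 'd F (p i + h i t *: v i) (derive1 (h i) t *: v i).
  move=> tab; have dFt := smooth_differentiable (p i + h i t *: v i) sF.
  rewrite -(derive1_comp_affine dFt (sh i t)).
  rewrite /velocity !derive1E; apply: near_eq_derive.
  have : nbhs t [set` `]a i, b i[] by apply: near_in_itvoo; rewrite in_itv.
  by apply: filterS => u /subset_itv_oo_cc /cE.
have tsE i j : i != j -> tangent_sign D (c i j) (c j i) = sgz (det2 (v i) (v j)).
  move=> ij; have ji : j != i by rewrite eq_sym.
  have [bi ci] := triangle_corner ij; have [bj cj] := triangle_corner ji.
  rewrite /tangent_sign (vE i) // (vE j) // -(eqE i j _ _ ci cj (triangle_corner_eq ij)).
  by rewrite sgz_det2_diffeo // h0.
exists p, v, h; split=> //.
- by move=> i s t si ti; apply: (derive1_gt0_mono (sh i) (h0 i)).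
- move=> i j ij; rewrite -sgz_eq0 -tsE //.
  by apply: tangent_sign_neq0; [exact: triangle_corner_neq|exact: triangle_corner_eq].
Qed.

(** In the chart the strands lie on lines with pairwise independent directions, so two of them meet
    only at their corner and none meets itself. The condition [a x.1 < a x.2] lists each chord once,
    with increasing parameters. *)
Lemma triangle_double_points :
  double_points_on [set t | exists i, t \in `[a i, b i]] D =
  (fun x => (c x.1 x.2, c x.2 x.1)) @` [set x : 'I_3 * 'I_3 | a x.1 < a x.2].
Proof.
have [p [v [h [hmono eqE detE _]]]] := triangle_lines.
rewrite predeqE => -[s t]; split=> [[[/= st e] [i si] [j tj]]|[[i j] /= aij [<- <-]]]; last first.
  have ij : i != j by apply/eqP => E; move: aij; rewrite E ltxx.
  have ji : j != i by rewrite eq_sym.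
  have [_ ci] := triangle_corner ij; have [_ cj] := triangle_corner ji.
  split=> /=; [split|by exists i|by exists j] => /=.
    by rewrite (triangle_order ij).
  exact: triangle_corner_eq.
have := eqE _ _ _ _ si tj e.
have [ij|ij] := eqVneq i j.
  subst j => /addrI /eqP; rewrite -subr_eq0 -scalerBl scaler_eq0 subr_eq0 => /orP[|/eqP v0].
    move=> /eqP hh; have := hmono i s t si tj; by rewrite hh ltxx st.
  (* A zero direction would contradict independence from any other strand. *)
  have [j ij] : exists j, i != j.
    by exists (if i == ord0 then ord_max else ord0); case: ifPn => // /eqP ->.
  by have := detE _ _ ij; rewrite v0 /det2 /= !mul0r subrr eqxx.
have ji : j != i by rewrite eq_sym.
have [_ ci] := triangle_corner ij; have [_ cj] := triangle_corner ji.
move=> E1; have E2 := eqE _ _ _ _ ci cj (triangle_corner_eq ij).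
have E3 : (h i s - h i (c i j)) *: v i = (h j t - h j (c j i)) *: v j.
  exact: lines_meet_sub E1 E2.
have inj l x y : x \in `[a l, b l] -> y \in `[a l, b l] -> h l x = h l y -> x = y.
  move=> xl yl hxy; have [xy|xy|//] := ltgtP x y.
    by have := hmono l x y xl yl; rewrite hxy ltxx xy.
  by have := hmono l y x yl xl; rewrite hxy ltxx xy.
have d1 : det2 (v j) (v j) = 0 by rewrite /det2; ring.
have d2 : det2 (v i) (v i) = 0 by rewrite /det2; ring.
exists (i, j) => /=; first by rewrite -(triangle_order ij si tj).
congr pair; apply/esym.
- apply: (inj i) => //; apply/eqP; rewrite -subr_eq0.
  have : (h i s - h i (c i j)) * det2 (v i) (v j) = 0 by rewrite -det2Zl E3 det2Zl d1 mulr0.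
  by move/eqP; rewrite mulf_eq0 (negbTE (detE _ _ ij)) orbF.
- apply: (inj j) => //; apply/eqP; rewrite -subr_eq0.
  have : (h j t - h j (c j i)) * det2 (v i) (v j) = 0 by rewrite -det2Zr -E3 det2Zr d2 mulr0.
  by move/eqP; rewrite mulf_eq0 (negbTE (detE _ _ ij)) orbF.
Qed.

Lemma triangle_corner_inj :
  set_inj [set x : 'I_3 * 'I_3 | a x.1 < a x.2] (fun x => (c x.1 x.2, c x.2 x.1)).
Proof.
have cinj i j i' j' : i != j -> i' != j' -> c i j = c i' j' -> i = i'.
  move=> ij ij' E; apply/eqP; apply/negPn/negP => ii.
  have [/andP[? ?] _] := triangle_corner ij; have [/andP[? ?] _] := triangle_corner ij'.
  by case: (sep ii) => ?; lra.
move=> [i j] [i' j']; rewrite !inE /= => l1 l2 [e1 e2].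
have n1 : i != j by apply/eqP => E; move: l1; rewrite E ltxx.
have n2 : i' != j' by apply/eqP => E; move: l2; rewrite E ltxx.
by congr pair; [apply: cinj e1|apply: cinj e2]; rewrite // eq_sym.
Qed.

(* The sides of a triangle with direction vectors [v], signed by the order of
   the corners along the strands, satisfy [alpha v_i - beta v_j + gamma v_k = 0]. *)
Lemma triangle_sign i j k : i != j -> j != k -> i != k ->
  tangent_sign D (c i k) (c k i) * sgz (c i k - c i j) =
  tangent_sign D (c j k) (c k j) * sgz (c j k - c j i).
Proof.
move=> ij jk ik; have [p [v [h [hmono eqE detE tsE]]]] := triangle_lines.
have ji : j != i by rewrite eq_sym.
have kj : k != j by rewrite eq_sym.
have ki : k != i by rewrite eq_sym.
rewrite !tsE //.
have [_ cij] := triangle_corner ij; have [_ cji] := triangle_corner ji.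
have [_ cik] := triangle_corner ik; have [_ cki] := triangle_corner ki.
have [_ cjk] := triangle_corner jk; have [_ ckj] := triangle_corner kj.
have sE l x y : x \in `[a l, b l] -> y \in `[a l, b l] -> sgz (y - x) = sgz (h l y - h l x).
  by move=> xl yl; rewrite !sgzB !hmono.
rewrite (sE i _ _ cij cik) (sE j _ _ cji cjk) -!sgzM.
have Eij := eqE _ _ _ _ cij cji (triangle_corner_eq ij).
have Eik := eqE _ _ _ _ cik cki (triangle_corner_eq ik).
have Ejk := eqE _ _ _ _ cjk ckj (triangle_corner_eq jk).
set alpha := h i _ - _; set beta := h j _ - _.
pose gamma := h k (c k j) - h k (c k i).
(* The path between two corners along strand [k] equals the path through the third corner. *)
have Ev : gamma *: v k = beta *: v j - alpha *: v i.
  move: Eij Eik Ejk; rewrite /alpha /beta /gamma.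
  move: (v i) (v j) (v k) (p i) (p j) (p k) => [x1 y1] [x2 y2] [x3 y3] [q1 r1] [q2 r2] [q3 r3].
  move=> [e1 e2] [e3 e4] [e5 e6]; congr pair; rewrite /GRing.scale /= in e1 e2 e3 e4 e5 e6 *;
    rewrite /GRing.scale /=; lra.
have d1 : gamma * det2 (v i) (v k) = beta * det2 (v i) (v j).
  by rewrite -det2Zr Ev /det2 /= /GRing.scale /=; ring.
have d2 : gamma * det2 (v j) (v k) = alpha * det2 (v i) (v j).
  by rewrite -det2Zr Ev /det2 /= /GRing.scale /=; ring.
(* If [gamma] is 0, independence of [v i] and [v j] makes all sides zero; otherwise [gamma] cancels,
   both products becoming [alpha * beta * det2 (v i) (v j)]. *)
congr sgz; have [g0|g0] := eqVneq gamma 0.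
  move: d1 d2; rewrite g0 !mul0r => /esym/eqP + /esym/eqP.
  by rewrite !mulf_eq0 !(negbTE (detE _ _ ij)) !orbF => /eqP -> /eqP ->; rewrite !mulr0.
apply: (mulfI g0); rewrite !mulrA d1 d2; ring.
Qed.

End StraightTriangle.
End Triangle.

(** * Triangle moves, and invariance of the polynomial *)

Section Invariance.
Context {R : realType}.
Implicit Types (D : diagram R) (i j k : 'I_3).

(** Excludes triangles with exactly one virtual crossing, those of the forbidden moves. Only then do
    the two crossings with the third strand count together in the index of a classical crossing. *)
Definition coherent (o : 'I_3 -> 'I_3 -> strand_info) : Prop :=
  forall i j k, i != j -> j != k -> i != k -> o i j <> Virtual ->
    (o i k = Virtual <-> o j k = Virtual).

Lemma layered_coherent o : layered o -> coherent o.
Proof.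
move=> [height ho] i j k ij jk ik _; rewrite !ho //.
by split; case: ifP.
Qed.

Lemma all_virtual_coherent o : all_virtual o -> coherent o.
Proof. by move=> vo i j k ij _ _; rewrite vo. Qed.

(** If [i] and [j] cross classically, the virtual strand is [k]; symmetry of the decoration turns
    its row into a column. *)
Lemma mixed_coherent o : (forall i j, i != j -> o j i = opposite (o i j)) ->
  mixed o -> coherent o.
Proof.
move=> osym [w [vw _]] i j k ij jk ik nv.
have vC x y : x != y -> o x y = Virtual -> o y x = Virtual.
  by move=> xy e; rewrite osym // e.
case: (ord3_cases w ij jk ik) => e; subst w.
- by case: nv; exact: vw.
- by case: nv; apply: vC; rewrite ?vw // eq_sym.
- by rewrite !(vC k) ?vw // eq_sym.
Qed.

(** Corresponding corners have the same sign and lie on the same arcs, so outer indices agree. For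
    an inner crossing, reversing the order along the strands changes two contributions, whose
    changes compensate by [triangle_sign]. *)
Lemma triangle_move_polynomial fr (allowed : ('I_3 -> 'I_3 -> strand_info) -> Prop) D D' :
  (forall o, (forall i j, i != j -> o j i = opposite (o i j)) ->
     allowed o -> coherent o) ->
  triangle_move allowed D D' -> diagram_polynomial fr D' = diagram_polynomial fr D.
Proof.
move=> hallowed [F [F' [a [b [c [c' [sep [_ lc] [st st'] rev [iE tE al]]]]]]]].
set A := [set t | _] in lc.
have clA : closed A.
  rewrite (_ : A = \bigcup_(i in [set: 'I_3]) [set` `[a i, b i]]).
    by apply: closed_bigcup => [|i _]; [exact: finite_finset|exact: interval_closed].
  by rewrite predeqE => t; split=> [[i ti]|[i _ ti]]; exists i.
have nA i u : ~ A u -> u \notin `[a i, b i] by move=> Au; apply/negP => ui; apply: Au; exists i.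
have cohD : coherent (fun i j => info D (c i j) (c j i)).
  apply: hallowed al => i j ij.
  by apply: info_sym; [exact: triangle_corner_neq st _ _ ij|exact: triangle_corner_eq st _ _ ij].
have csE i j : i != j ->
    chord_sign D' (c' i j) (c' j i) = chord_sign D (c i j) (c j i) /\
    crossing_sign D' (c' i j) (c' j i) = crossing_sign D (c i j) (c j i).
  move=> ij; have ji : j != i by rewrite eq_sym.
  by rewrite /chord_sign /crossing_sign (iE i j ij) (tE i j ij) (tE j i ji).
have neq i j : a i < a j -> i != j by move=> h; apply/eqP => E; move: h; rewrite E ltxx.
have sum_on (E : diagram R) G e (V : nmodType) (f : R * R -> V) : straight_triangle G a b e E ->
    \sum_(x \in double_points_on A E) f x =
    \sum_(x \in [set x : 'I_3 * 'I_3 | a x.1 < a x.2]) f (e x.1 x.2, e x.2 x.1).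
  move=> stE; rewrite (triangle_double_points sep stE) fsbig_image //.
  exact: triangle_corner_inj stE.
apply: (local_change_polynomial clA lc) => [d d1 d2|].
  rewrite /chord_sum (sum_on _ _ _ _ _ st) (sum_on _ _ _ _ _ st').
  apply: eq_fsbigr => -[i j]; rewrite inE /= => /neq ij; have ji : j != i by rewrite eq_sym.
  have [_ ci] := triangle_corner st ij; have [_ ci'] := triangle_corner st' ij.
  have [_ cj] := triangle_corner st ji; have [_ cj'] := triangle_corner st' ji.
  rewrite (csE _ _ ij).1.
  by rewrite (between_itv (nA i _ d1) (nA i _ d2) ci ci') (between_itv (nA j _ d1) (nA j _ d2) cj cj').
rewrite (sum_on _ _ _ _ _ st) (sum_on _ _ _ _ _ st').
apply: eq_fsbigr => -[i j]; rewrite inE /= => aij; have ij := neq _ _ aij.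
have ji : j != i by rewrite eq_sym.
rewrite /crossing_term /= (csE _ _ ij).2.
have [v|nv] := pselect (info D (c i j) (c j i) = Virtual).
  by rewrite /crossing_sign v !scale0r.
congr (_ *: crossing_weight _ _).
have [k [jk ik]] := ord3_third ij.
have kj : k != j by rewrite eq_sym.
have ki : k != i by rewrite eq_sym.
apply: (local_change_chord_sum clA lc).
  move=> u Au; rewrite /between /=; congr ((nat_of_bool _)%:R).
  have [_ ci] := triangle_corner st ij; have [_ ci'] := triangle_corner st' ij.
  have [_ cj] := triangle_corner st ji; have [_ cj'] := triangle_corner st' ji.
  by rewrite (itv_side (nA i u Au) ci ci') (itv_side (nA j u Au) cj cj').
pose f (E : diagram R) (e : 'I_3 -> 'I_3 -> R) x y : int := chord_sign E (e x y) (e y x) *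
  (between (e i j, e j i) (e x y) - between (e i j, e j i) (e y x)).
have sum3 (E : diagram R) G e : straight_triangle G a b e E ->
    chord_sum (double_points_on A E) E (e i j, e j i) =
    f E e i j + f E e i k + f E e j k.
  move=> stE; rewrite /chord_sum (sum_on _ _ _ _ _ stE).
  apply: (@fsum_tournament _ (fun x y => a x < a y) (f E e)) => //.
  - move=> x y xy; rewrite -leNgt le_eqVlt orbC; case: (ltP (a y) (a x)) => //= _.
    apply/esym/negbTE/eqP => axy.
    have yx : y != x by rewrite eq_sym.
    have [/andP[? ?] _] := triangle_corner stE xy.
    have [/andP[? ?] _] := triangle_corner stE yx.
    by case: (sep _ _ xy) => ?; lra.
  - by move=> x; rewrite ltxx.
  - move=> x y xy; rewrite /f chord_signC ?mulNr -?mulrN ?opprB //.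
      exact: triangle_corner_neq stE _ _ xy.
    exact: triangle_corner_eq stE _ _ xy.
(* Tells whether strand [k] is traversed between strands [i] and [j], which is the same before and
   after the move. *)
pose kappa : int := (a i < a k < a j)%R%:R.
have fE (E : diagram R) G e : straight_triangle G a b e E ->
    f E e i j + f E e i k + f E e j k =
    chord_sign E (e i k) (e k i) * ((e i j < e i k)%R%:R - kappa) +
    chord_sign E (e j k) (e k j) * ((e j k < e j i)%R%:R - kappa).
  move=> stE; have [_ eij] := triangle_corner stE ij; have [_ eji] := triangle_corner stE ji.
  have [_ eik] := triangle_corner stE ik; have [_ eki] := triangle_corner stE ki.
  have [_ ejk] := triangle_corner stE jk; have [_ ekj] := triangle_corner stE kj.
  have bE x : between (e i j, e j i) x = (e i j < x < e j i)%R%:R by [].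
  have -> : f E e i j = 0 by rewrite /f !bE !ltxx andbF subrr mulr0.
  rewrite add0r /f !bE (triangle_order sep ij eik eji) aij andbT.
  rewrite (triangle_order sep ij eij ejk) aij andTb.
  rewrite (triangle_order sep ik eij eki) (triangle_order sep kj eki eji).
  by rewrite (triangle_order sep ik eij ekj) (triangle_order sep kj ekj eji).
rewrite (sum3 _ _ _ st) (sum3 _ _ _ st') (fE _ _ _ st) (fE _ _ _ st').
rewrite (csE _ _ ik).1 (csE _ _ jk).1.
rewrite -(rev i k j) // -(rev j i k) //.
(* After the move the indicators [p, q] become the reversed ones [p', q']. The premise, read through
   [sgzB], is the relation between the sides of the triangle. *)
have rearrange (X Y p p' q q' z : int) : X * (p - p') = Y * (q' - q) ->
    X * (p' - z) + Y * (q' - z) = X * (p - z) + Y * (q - z).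
  by rewrite !mulrBr => e; lra.
have [h1 h2] := cohD i j k ij jk ik nv.
have [v|nik] := pselect (info D (c i k) (c k i) = Virtual).
  by rewrite (chord_sign_virtual v) (chord_sign_virtual (h1 v)) !mul0r.
have njk : info D (c j k) (c k j) <> Virtual by move=> /h2.
rewrite (chord_sign_classical nik) (chord_sign_classical njk).
apply: rearrange; rewrite -!sgzB; exact: triangle_sign sep st _ _ _ ij jk ik.
Qed.

Lemma move_polynomial fr D D' :
  move fr D D' -> diagram_polynomial fr D' = diagram_polynomial fr D.
Proof.
case=> {fr D D'} [fr|||fr|fr|fr|fr|fr|fr] D D'.
- exact: planar_isotopy_polynomial.
- by apply: kink_move_polynomial; right.
- exact: double_kink_move_polynomial.
- exact: bigon_move_polynomial.
- by apply: triangle_move_polynomial => o _; exact: layered_coherent.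
- by apply: kink_move_polynomial; left.
- exact: bigon_move_polynomial.
- by apply: triangle_move_polynomial => o _; exact: all_virtual_coherent.
- by apply: triangle_move_polynomial; exact: mixed_coherent.
Qed.

Lemma equivalent_polynomial fr D D' :
  equivalent fr D D' -> diagram_polynomial fr D = diagram_polynomial fr D'.
Proof.
elim=> {D D'} [x y /move_polynomial ->|//|x y _ ->|x y z _ -> _ ->] //.
Qed.

(** Invariance under the moves frees [p_t] from its chosen representative. *)
Lemma p_tE fr (K : long_virtual_knot R fr) D :
  diagrams_of K D -> p_t K = diagram_polynomial fr D.
Proof.
rewrite /p_t /representative; case: cid => D0 /= -> D0D.
exact: equivalent_polynomial.
Qed.

Lemma connected_sum_p_t fr (K1 K2 K : long_virtual_knot R fr) :
  connected_sum K1 K2 K -> p_t K = p_t K1 + p_t K2.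
Proof.
move=> [D1 [D2 [D [/p_tE -> /p_tE -> /p_tE -> ]]]].
exact: concatenation_polynomial.
Qed.

End Invariance.

Theorem proposition7 (R : realType) (fr : framing)
    (K1 K2 K12 K21 : long_virtual_knot R fr)
    (sum12 : connected_sum K1 K2 K12) (sum21 : connected_sum K2 K1 K21) :
  p_t K12 = p_t K1 + p_t K2 /\ p_t K12 = p_t K21.
Proof.
have e12 := connected_sum_p_t sum12; have e21 := connected_sum_p_t sum21.
by split; [exact: e12|rewrite e12 e21; exact: addrC].
Qed.
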